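(* For all positive integers $n$ and non-negative integers $k$, we have $$\det_{0\le i,j\le n-1}\left(\mathcal P^+_{i+j}(0,k)\right)=\begin{cases} (-1)^{n_1\binom{k+1}{2}}(xy)^{(k+1)^2\binom{n_1}{2}} & \text{if } n=n_1(k+1) \text{ with } n_1 \text{ an integer},\\ 0 & \text{if } n\not\equiv 0 \pmod{k+1}.\end{cases}$$
   Context: $x,y$ are indeterminates. A three-step path is a lattice path in $\mathbb Z^2$ consisting of steps from $\{(1,0),(1,1),(1,-1)\}$. The steps have weights $w((1,0))=x+y$, $w((1,1))=1$, $w((1,-1))=xy$, and the weight $w(P)$ of a path $P$ is the product of the weights of its steps (the empty path has weight $1$). For integers $n\ge 0$ and $l,k\ge0$, $\mathcal P^+_n(l,k)=\sum_P w(P)$, where the sum is over all three-step paths $P$ from $(0,l)$ to $(n,k)$ which never run below the $x$-axis. For $k=0$ only the first case on the right-hand side applies. *)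

(* Defs.v *)
From mathcomp Require Import all_boot all_order all_algebra.
From mathcomp Require Import mpoly.
Set Implicit Arguments.
Unset Strict Implicit.
Unset Printing Implicit Defensive.
Import GRing.Theory Num.Theory.
Local Open Scope ring_scope.

Definition x : {mpoly int[2]} := 'X_0.
Definition y : {mpoly int[2]} := 'X_1.

Definition steps : seq (int * int) := [:: (1, 0); (1, 1); (1, -1)].

(* A step is literally a displacement vector of Z^2 belonging to [steps];
   [seq_sub] provides the finType structure needed to sum over paths. *)
Definition step : finType := seq_sub steps.

Definition step_weight (s : step) : {mpoly int[2]} :=
  if val s == (1, 0) then x + y
  else if val s == (1, 1) then 1
  else x * y.

Definition path_weight (p : seq step) : {mpoly int[2]} :=
  \prod_(s <- p) step_weight s.

(* The lattice points visited after the starting point [a], in order. *)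
Definition points (a : int * int) (p : seq step) : seq (int * int) :=
  scanl +%R a (map val p).

Definition path_end (a : int * int) (p : seq step) : int * int :=
  last a (points a p).

(* Steps are straight segments, so it suffices to test the lattice points. *)
Definition above_axis (a : int * int) (p : seq step) : bool :=
  all (fun v : int * int => 0 <= v.2) (a :: points a p).

(* Every step increases the abscissa by 1, so a path from (0, l) to (n, k)
   has exactly n steps: summing over [n.-tuple step] omits no path. *)
Definition Pplus (n l k : nat) : {mpoly int[2]} :=
  \sum_(p : n.-tuple step | (path_end (0, l%:Z) p == (n%:Z, k%:Z))
                            && above_axis (0, l%:Z) p)
    path_weight p.

(* Main.v *)
(* With q = xy, the numbers P^+_n(0,k) are dual to the polynomials defined by
   X U_l = U_{l+1} + (x+y) U_l + q U_{l-1}: the linear functional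
   X^n |-> P^+_n(0,k) sends U_l to [k = l]. By unitriangular row and column
   operations the Hankel determinant equals that of the values of this
   functional at T_i U_j, where T_0 = 1 and T_i = U_i - q U_{i-2} is monic. For
   i > 0, T_i U_j is U_{i+j} + q^i U_{j-i} if i <= j and
   U_{i+j} - q^(j+1) U_{i-j-2} otherwise, with U_{-1} = 0, so the new matrix is
   sparse; its leading (k+1) x (k+1) block is antidiagonal, and the Schur
   complement of that block is q^(k+1) times the same matrix of size n-k-1. When
   0 < n <= k the first row vanishes. *)
From HB Require Import structures.
Require Import Defs.
From mathcomp Require Import all_boot all_order all_algebra.
From mathcomp Require Import mpoly.
From mathcomp Require Import zify ring.
Set Implicit Arguments.
Unset Strict Implicit.
Unset Printing Implicit Defensive.
Import GRing.Theory Num.Theory.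
Local Open Scope ring_scope.

(** * Moment functionals and Hankel determinants *)

Section MomentFunctional.
Variables (R : comNzRingType) (c : nat -> R).

Definition moment (f : {poly R}) : R := \sum_(i < size f) f`_i * c i.

(** Coefficients beyond the size vanish, so several polynomials can share one summation range. *)
Lemma momentE (n : nat) (f : {poly R}) : (size f <= n)%N ->
  moment f = \sum_(i < n) f`_i * c i.
Proof.
move=> le_n; rewrite /moment (big_ord_widen n (fun i => f`_i * c i)) //.
rewrite big_mkcond; apply: eq_bigr => i _.
by case: ltnP => // le_i; rewrite nth_default // mul0r.
Qed.

Lemma moment_is_scalar : scalar moment.
Proof.
move=> a f g; set n := maxn (size f) (size g).
rewrite (@momentE n (a *: f + g)); last first.
  rewrite (leq_trans (size_polyD _ _)) // geq_max.
  by rewrite (leq_trans (size_scale_leq _ _)) ?leq_max ?leqnn ?orbT.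
rewrite (@momentE n f) ?(@momentE n g) ?leq_max ?leqnn ?orbT //.
rewrite mulr_sumr -big_split; apply: eq_bigr => i _ /=.
by rewrite coefD coefZ mulrDl -mulrA.
Qed.

HB.instance Definition _ :=
  GRing.isLinear.Build R {poly R} R *%R moment moment_is_scalar.

Lemma momentXn (n : nat) : moment 'X^n = c n.
Proof.
rewrite (@momentE n.+1) ?size_polyXn // big_ord_recr /= coefXn eqxx mul1r.
rewrite big1 ?add0r // => i _; rewrite coefXn.
by rewrite ltn_eqF ?mul0r.
Qed.

(** The first matrix factors as [F *m (H *m G^T)], where [F] and [G] hold the coefficients of the
    two families and are unitriangular. *)
Lemma det_moment_unitriangular (n : nat) (f g : nat -> {poly R}) :
    (forall i, size (f i) <= i.+1)%N -> (forall i, (f i)`_i = 1) ->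
    (forall i, size (g i) <= i.+1)%N -> (forall i, (g i)`_i = 1) ->
  \det (\matrix_(i < n, j < n) moment (f i * g j)) =
  \det (\matrix_(i < n, j < n) c (i + j)).
Proof.
have det1 (h : nat -> {poly R}) : (forall i, size (h i) <= i.+1)%N ->
    (forall i, (h i)`_i = 1) -> \det (\matrix_(i < n, j < n) (h i)`_j) = 1.
  move=> sz_h h1; rewrite det_trig.
    by rewrite big1 // => i _; rewrite mxE h1.
  apply/is_trig_mxP => i j lt_ij; rewrite mxE nth_default //.
  exact: leq_trans (sz_h i) lt_ij.
move=> sz_f f1 sz_g g1.
pose F := \matrix_(i < n, j < n) (f i)`_j.
pose G := \matrix_(i < n, j < n) (g i)`_j.
pose H := \matrix_(i < n, j < n) c (i + j).
suff -> : \matrix_(i < n, j < n) moment (f i * g j) = F *m (H *m G^T).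
  by rewrite !det_mulmx det_tr !det1 // mul1r mulr1.
have polyE (h : nat -> {poly R}) (i : 'I_n) : (size (h i) <= i.+1)%N ->
    h i = \sum_(a < n) (h i)`_a *: 'X^a.
  move=> sz_h; rewrite -poly_def; apply/polyP=> a; rewrite coef_poly.
  case: ltnP => // le_a; rewrite nth_default //.
  exact: leq_trans (leq_trans sz_h (ltn_ord i)) le_a.
apply/matrixP=> i j; rewrite !mxE.
rewrite {1}(polyE f i) // {1}(polyE g j) // mulr_suml linear_sum.
apply: eq_bigr => a _; rewrite !mxE mulr_sumr linear_sum mulr_sumr.
apply: eq_bigr => b _; rewrite !mxE -scalerAl -scalerAr -exprD !linearZ /=.
by rewrite momentXn [c _ * _]mulrC.
Qed.

End MomentFunctional.

(** * Rescaled Chebyshev polynomials and their duality with the array [c] *)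

Section Chebyshev.
Variables (R : comNzRingType) (b q : R).

(** With t = (X - b) / (2 sqrt q), the seeds of [chebU] produce q^(n/2) U_n(t) and those of [chebT]
    produce 2 q^(n/2) T_n(t), for the classical U_n and T_n. *)
Fixpoint cheb (f0 f1 : {poly R}) (n : nat) : {poly R} :=
  match n with
  | 0 => f0
  | 1 => f1
  | (m.+1 as n').+1 => ('X - b%:P) * cheb f0 f1 n' - q *: cheb f0 f1 m
  end.

Arguments cheb : simpl never.

Lemma chebSS (f0 f1 : {poly R}) (n : nat) :
  cheb f0 f1 n.+2 = ('X - b%:P) * cheb f0 f1 n.+1 - q *: cheb f0 f1 n.
Proof. by []. Qed.

Definition chebU : nat -> {poly R} := cheb 1 ('X - b%:P).

(* The seed 2 makes the recurrence of the first-kind polynomials valid from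
   index 0 on; the polynomial of index 0 is then not monic. *)
Definition chebT : nat -> {poly R} := cheb 2%:R%:P ('X - b%:P).

Lemma size_cheb (d : R) (n : nat) :
  (size (cheb d%:P ('X - b%:P) n) <= n.+1)%N.
Proof.
elim/ltn_ind: n => -[_|[_|n IHn]]; first exact: size_polyC_leq1.
  by rewrite size_XsubC.
rewrite chebSS; apply: (leq_trans (size_polyD _ _)).
rewrite size_polyN geq_max; apply/andP; split.
  apply: (leq_trans (size_polyMleq _ _)); rewrite size_XsubC.
  exact: IHn (ltnSn _).
apply: (leq_trans (size_scale_leq _ _)).
by apply: leq_trans (IHn n _) _; rewrite // ltnW.
Qed.

Lemma lead_cheb (d : R) (n : nat) : (cheb d%:P ('X - b%:P) n.+1)`_n.+1 = 1.
Proof.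
elim: n => [|n IHn]; first by rewrite coefB coefX coefC subr0.
have sz0 := size_cheb d n; have sz1 := size_cheb d n.+1.
rewrite chebSS coefB coefZ mulrBl coefB coefXM coefCM; move: IHn sz0 sz1.
move: (cheb _ _ n) (cheb _ _ n.+1) => f g IHn sz0 sz1.
rewrite IHn [g`_n.+2]nth_default // [f`_n.+2]nth_default ?mulr0 ?subr0 //.
exact: leq_trans sz0 _.
Qed.

Variable c : nat -> nat -> R.
Hypothesis c0 : forall k, c 0 k = (k == 0)%N%:R.
Hypothesis cS : forall n k,
  c n.+1 k = (if k is k'.+1 then c n k' else 0) + b * c n k + q * c n k.+1.

Local Notation phi k := (moment (c^~ k)).

(** This is the recurrence [cS] read on functionals; shifting by [b] removes its middle term. *)
Lemma momentXsubC (k : nat) (f : {poly R}) :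
  phi k (('X - b%:P) * f) =
  (if k is k'.+1 then phi k' f else 0) + q * phi k.+1 f.
Proof.
rewrite mulrBl linearB /= mul_polyC linearZ /=.
have szX : (size ('X * f)%R <= (size f).+1)%N.
  by rewrite (leq_trans (size_polyMleq _ _)) // size_polyX.
rewrite (momentE _ szX) big_ord_recl /= coefXM mul0r add0r.
have ->: \sum_(i < size f) ('X * f)`_(bump 0 i) * c (bump 0 i) k =
  (if k is k'.+1 then phi k' f else 0) + b * phi k f + q * phi k.+1 f.
  have -> : (if k is k'.+1 then phi k' f else 0) =
    \sum_(i < size f) f`_i * (if k is k'.+1 then c i k' else 0).
    by case: k {szX} => //; rewrite big1 // => i _; rewrite mulr0.
  rewrite /moment !mulr_sumr -!big_split /=; apply: eq_bigr => i _.
  rewrite coefXM /= add0n cS.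
  rewrite !mulrDr; congr (_ + _ + _); apply: mulrCA.
by rewrite addrAC addrK.
Qed.

(** Induction on [l] for all [k] at once: the term in [phi k.+1] from [momentXsubC] cancels against
    [q *: chebU l]. *)
Lemma moment_chebU (l k : nat) : phi k (chebU l) = (k == l)%:R.
Proof.
have phi1 m : phi m 1 = (m == 0)%N%:R.
  by rewrite -[1](expr0 'X) momentXn c0.
elim/ltn_ind: l k => -[_ k|[_ k|l IHl k]]; first exact: phi1.
  rewrite /chebU /cheb -[_ - _]mulr1 momentXsubC phi1 mulr0 addr0.
  by case: k => [|k] //; rewrite phi1.
rewrite /chebU chebSS linearB linearZ /= momentXsubC.
rewrite -!/(chebU _) !IHl // eqSS addrK.
by case: k => [|k] //; rewrite IHl // eqSS.
Qed.

(** The coefficient of U_k in T_i U_j = U_{i+j} + q^i U_{j-i}. The last term covers negative indices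
    through the reflection U_{-m-2} = - q^(-m-1) U_m. *)
Definition chebTU_coef (k i j : nat) : R :=
  (i + j == k)%N%:R + q ^+ i * (j == i + k)%N%:R
  - q ^+ j.+1 * (i == k + j + 2)%N%:R.

Lemma moment_chebTU (i j k : nat) :
  phi k (chebT i * chebU j) = chebTU_coef k i j.
Proof.
elim/ltn_ind: i k => -[_ k|[_ k|i IHi k]].
- rewrite /chebT /cheb mul_polyC linearZ /= moment_chebU /chebTU_coef.
  have -> : (0 == k + j + 2)%N = false by lia.
  rewrite eq_sym mulr0 subr0 add0n; ring.
- rewrite /chebT /cheb momentXsubC moment_chebU /chebTU_coef.
  have -> : (1 == k + j + 2)%N = false by lia.
  rewrite mulr0 subr0 expr1 eq_sym; congr (_ + _).
  by case: k => [|k]; rewrite ?moment_chebU //= eqSS eq_sym.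
rewrite /chebT chebSS mulrBl -mulrA -scalerAl linearB linearZ /= momentXsubC.
rewrite -!/(chebT _) !IHi //.
case: k => [|k]; rewrite ?IHi // /chebTU_coef.
- have -> : (i.+1 + j == 1)%N = (i + j == 0)%N by lia.
  have -> : (i.+2 + j == 0)%N = false by lia.
  have -> : (j == i.+1 + 1)%N = (j == i.+2 + 0)%N by lia.
  have -> : (i.+1 == 1 + j + 2)%N = (i == 0 + j + 2)%N by lia.
  have -> : (i.+2 == 0 + j + 2)%N = (j == i + 0)%N by lia.
  (* At height 0 the leftover - q^(i+1) must serve as the reflected term - q^(j+1); the two agree
     because j = i there. *)
  case: (@eqP _ j (i + 0)%N) => [->|_]; rewrite ?addn0 ?exprS /=; ring.
have -> : (i.+1 + j == k)%N = (i.+2 + j == k.+1)%N by lia.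
have -> : (i.+1 + j == k.+2)%N = (i + j == k.+1)%N by lia.
have -> : (j == i.+1 + k)%N = (j == i + k.+1)%N by lia.
have -> : (j == i.+1 + k.+2)%N = (j == i.+2 + k.+1)%N by lia.
have -> : (i.+1 == k + j + 2)%N = (i.+2 == k.+1 + j + 2)%N by lia.
have -> : (i.+1 == k.+2 + j + 2)%N = (i == k.+1 + j + 2)%N by lia.
rewrite !exprS; ring.
Qed.

(* [chebTU_coef] with row 0 corrected for the monic polynomial 1. *)
Definition reduced_hankel (k i j : nat) : R :=
  if i is 0 then (j == k)%:R else chebTU_coef k i j.

Lemma det_hankel_reduced (n k : nat) :
  \det (\matrix_(i < n, j < n) c (i + j) k) =
  \det (\matrix_(i < n, j < n) reduced_hankel k i j).
Proof.
pose T i := if i is 0 then 1 else chebT i.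
rewrite -(@det_moment_unitriangular _ (c^~ k) n T chebU).
- congr (\det _); apply/matrixP => i j; rewrite !mxE /T /reduced_hankel.
  case: (i : nat) => [|i']; last by rewrite moment_chebTU.
  by rewrite mul1r moment_chebU eq_sym.
- by case=> [|i]; rewrite ?size_poly1 //; apply: size_cheb.
- by case=> [|i]; rewrite ?coef1 //; apply: lead_cheb.
- exact: size_cheb.
by case=> [|i]; rewrite ?coef1 //; apply: lead_cheb.
Qed.

End Chebyshev.

(** * Evaluation of the sparse determinant by block elimination *)

Section Determinant.
Variables (R : comNzRingType) (q : R).

Lemma det_antidiagonal (k : nat) :
  \det (\matrix_(i < k, j < k) ((i + j).+1 == k)%:R : 'M[R]_k) =
  (-1) ^+ 'C(k, 2).
Proof.
elim: k => [|k IHk]; first by rewrite det_mx00.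
rewrite (expand_det_row _ ord0) (bigD1 ord_max) //= big1 => [|j ne_j].
  rewrite addr0 mxE add0n eqxx mul1r /cofactor add0n binS bin1 addnC exprD -IHk.
  congr (_ * \det _); apply/matrixP => i j; rewrite !mxE /= /bump /=.
  by rewrite leqNgt ltn_ord add0n add1n.
rewrite mxE; suff -> : (0 + j).+1 == k.+1 = false by rewrite mul0r.
by rewrite add0n eqSS; apply: contraNF ne_j => /eqP jk; apply/eqP/val_inj.
Qed.

(** The strict bound on [d] rules out [i = 0]: the elimination below therefore leaves the first row
    under the leading block unchanged. *)
Lemma sum_antidiagonal (k i : nat) (F : nat -> R) :
  \sum_(d < k) (i + d == k)%N%:R * F d =
  if (0 < i <= k)%N then F (k - i)%N else 0.
Proof.
case: ifP => [/andP[i_gt0 le_ik]|/negP no_d].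
  have lt_d : (k - i < k)%N by lia.
  rewrite (bigD1 (Ordinal lt_d)) //=.
  rewrite subnKC // eqxx mul1r big1 ?addr0 // => d.
  rewrite -val_eqE /= => ne_d.
  suff -> : (i + d == k)%N = false by rewrite mul0r.
  by apply: contraNF ne_d => /eqP id; apply/eqP; lia.
rewrite big1 // => d _; have lt_d := ltn_ord d.
suff -> : (i + d == k)%N = false by rewrite mul0r.
apply/eqP => id; apply: no_d; lia.
Qed.

Lemma reduced_hankel_ul (k i j : nat) : (i <= k)%N -> (j <= k)%N ->
  reduced_hankel q k i j = (i + j == k)%N%:R.
Proof.
case: i => [|i] le_i le_j //=; rewrite /chebTU_coef.
have -> : (j == i.+1 + k)%N = false by lia.
have -> : (i.+1 == k + j + 2)%N = false by lia.
by rewrite !mulr0 subr0 addr0.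
Qed.

Lemma reduced_hankel_ur (k i j : nat) : (i <= k)%N ->
  reduced_hankel q k i (k.+1 + j) = q ^+ i * (i == j.+1)%:R.
Proof.
case: i => [|i] le_i /=.
  by have -> : (k.+1 + j == k)%N = false; [lia | rewrite mulr0].
rewrite /chebTU_coef.
have -> : (i.+1 + (k.+1 + j) == k)%N = false by lia.
have -> : (k.+1 + j == i.+1 + k)%N = (i.+1 == j.+1) by lia.
have -> : (i.+1 == k + (k.+1 + j) + 2)%N = false by lia.
by rewrite mulr0 subr0 add0r.
Qed.

Lemma reduced_hankel_d (k i j : nat) :
  reduced_hankel q k (k.+1 + i) j =
  q ^+ (k.+1 + i) * (j == k.+1 + i + k)%N%:R - q ^+ j.+1 * (i == j.+1)%:R.
Proof.
rewrite addSn /= /chebTU_coef.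
have -> : ((k + i).+1 + j == k)%N = false by lia.
have -> : ((k + i).+1 == k + j + 2)%N = (i == j.+1) by lia.
by rewrite add0r.
Qed.

Lemma det_reduced_hankel_step (k m : nat) :
  \det (\matrix_(i < k.+1 + m, j < k.+1 + m) reduced_hankel q k i j) =
  (-1) ^+ 'C(k.+1, 2) * q ^+ (k.+1 * m) *
  \det (\matrix_(i < m, j < m) reduced_hankel q k i j).
Proof.
set M := \matrix_(i < k.+1 + m, j < _) _.
pose A : 'M[R]_k.+1 := \matrix_(i, j) ((i + j).+1 == k.+1)%:R.
(* [E] is [- C *m A], where [C] is the lower left block of [M]: the leading
   block [A] is its own inverse. *)
pose E : 'M[R]_(m, k.+1) := \matrix_(i, d) ((i + d == k.+1)%N%:R * q ^+ i).
pose N : 'M[R]_m := \matrix_(i, j) reduced_hankel q k i j.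
have elim_M : block_mx 1%:M 0 E 1%:M *m M =
    block_mx A (ursubmx M) 0 (q ^+ k.+1 *: N).
  rewrite -[M]submxK mulmx_block !mul1mx !mul0mx !addr0.
  congr block_mx.
  - by apply/matrixP => i j; rewrite !mxE eqSS reduced_hankel_ul //= leq_ord.
  - by rewrite submxK.
  (* In the lower left block the only nonzero entries, - q^(c+1) at i = c + 1, are cancelled. *)
  - apply/matrixP => i c; rewrite !mxE.
    under eq_bigr => d _ do rewrite !mxE /= -mulrA.
    rewrite (sum_antidiagonal k.+1 i
      (fun d => q ^+ i * reduced_hankel q k d c)).
    rewrite reduced_hankel_d /=; have lt_c := ltn_ord c.
    have -> : ((c : nat) == k.+1 + i + k)%N = false by lia.
    rewrite mulr0 sub0r; case: ifP => [/andP[i_gt0 le_i]|].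
      rewrite reduced_hankel_ul; try lia.
      have -> : (k.+1 - i + c == k)%N = (i == c.+1 :> nat) by lia.
      by case: eqP => [->|_]; rewrite ?mulr0 subrr.
    case: eqP => [->|_ _]; first by rewrite lt_c.
    by rewrite mulr0 subrr.
  apply/matrixP => i j; rewrite !mxE.
  under eq_bigr => d _ do rewrite !mxE /= -mulrA.
  rewrite (sum_antidiagonal k.+1 i
    (fun d => q ^+ i * reduced_hankel q k d (k.+1 + j))).
  (* Row 0 already equals q^(k+1) times the corrected row 0. In the other rows the old entries give
     the last two terms of [chebTU_coef], and the row operation gives the first. *)
  rewrite reduced_hankel_d /=; case: (i : nat) => [|i'] /=.
    rewrite mulr0 subr0 add0r addn0.
    by have -> : (k.+1 + j == k.+1 + k)%N = (j == k :> nat) by lia.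
  rewrite /chebTU_coef.
  have -> : (k.+1 + j == k.+1 + i'.+1 + k)%N = (j == i'.+1 + k :> nat)%N by lia.
  have -> : (i'.+1 == (k.+1 + j).+1)%N = (i'.+1 == k + j + 2)%N by lia.
  rewrite mulrBr mulrDr addrA !mulrA -!exprD [(_ + j.+1)%N]addnS.
  congr (_ + _ + _).
  case: ifP => [le_i|no_i].
    rewrite reduced_hankel_ur; last by lia.
    rewrite mulrA -exprD subnKC //.
    by have -> : (k.+1 - i'.+1 == j.+1)%N = (i'.+1 + j == k)%N by lia.
  by have -> : (i'.+1 + j == k)%N = false; [lia | rewrite mulr0].
have := congr1 determinant elim_M.
rewrite det_mulmx det_lblock det_ublock !det1 !mul1r => ->.
by rewrite det_antidiagonal detZ mulrA exprM.
Qed.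

Lemma det_reduced_hankel_small (k n : nat) : (0 < n <= k)%N ->
  \det (\matrix_(i < n, j < n) reduced_hankel q k i j) = 0.
Proof.
case: n => // n /= lt_nk; rewrite (expand_det_row _ ord0) big1 // => j _.
by rewrite mxE /= ltn_eqF ?mul0r // (leq_trans (ltn_ord j)).
Qed.

(** Peeling off [n1] leading blocks leaves a matrix of size [r], which is empty or has determinant
    0. *)
Lemma det_reduced_hankel (k n1 r : nat) : (r <= k)%N ->
  \det (\matrix_(i < n1 * k.+1 + r, j < n1 * k.+1 + r) reduced_hankel q k i j) =
  if r == 0%N then (-1) ^+ (n1 * 'C(k.+1, 2)) * q ^+ (k.+1 ^ 2 * 'C(n1, 2))
  else 0.
Proof.
move=> le_rk; elim: n1 => [|n1 IHn1].
  case: eqP => [->|/eqP r0]; first by rewrite det_mx00 mul0n muln0 mulr1.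
  by rewrite det_reduced_hankel_small // lt0n r0.
rewrite mulSn -addnA det_reduced_hankel_step IHn1.
case: eqP => [->|_]; last by rewrite mulr0.
(* The peeled block contributes the exponent (k+1)^2 n1, matching C(n1+1, 2) = C(n1, 2) + n1. *)
rewrite mulrACA -!exprD; congr (_ ^+ _ * _ ^+ _).
by rewrite binS bin1 addn0 -mulnn; lia.
Qed.

End Determinant.

(** * Last-step recurrence for weighted paths *)

Section Paths.

(** The final height is an integer so that the recurrence may refer to height -1; at natural heights
    this is convertible to [Pplus n 0]. *)
Definition paths_sum (n : nat) (m : int) : {mpoly int[2]} :=
  \sum_(p : n.-tuple step | (path_end (0, 0%:Z) p == (n%:Z, m))
                            && above_axis (0, 0%:Z) p)
    path_weight p.

Lemma path_end_rcons (a : int * int) (p : seq step) (s : step) :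
  path_end a (rcons p s) = path_end a p + val s.
Proof.
rewrite /path_end /points map_rcons scanl_rcons last_rcons.
by elim: p a => //= t p IHp a; rewrite -IHp.
Qed.

Lemma above_axis_rcons (a : int * int) (p : seq step) (s : step) :
  above_axis a (rcons p s) =
  above_axis a p && (0 <= (path_end a (rcons p s)).2).
Proof.
rewrite /above_axis /path_end /points map_rcons scanl_rcons last_rcons.
by rewrite -rcons_cons all_rcons andbC.
Qed.

Lemma above_axis_end (a : int * int) (p : seq step) :
  above_axis a p -> 0 <= (path_end a p).2.
Proof. by move/allP; apply; apply: mem_last. Qed.

Lemma big_tuple_rcons (V : nmodType) (T : finType) (n : nat) (P : pred (seq T))
    (F : seq T -> V) :
  \sum_(p : n.+1.-tuple T | P p) F p =
  \sum_(s : T) \sum_(p : n.-tuple T | P (rcons p s)) F (rcons p s).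
Proof.
rewrite pair_big_dep /=.
rewrite (reindex (fun u : T * n.-tuple T => [tuple of rcons u.2 u.1])) //.
apply: onW_bij; apply: inj_card_bij.
  case=> s p [t r] /(congr1 val) /= /rcons_inj[] /val_inj -> -> //.
by rewrite card_prod !card_tuple expnS.
Qed.

Lemma big_step (V : nmodType) (F : int * int -> V) :
  \sum_(s : step) F (val s) = F (1, 0) + F (1, 1) + F (1, -1).
Proof.
have val_enum : map val (enum step) = steps.
  by rewrite enumT unlock [LHS]val_seq_sub_enum.
rewrite -big_enum -(big_map val xpredT F) val_enum.
by rewrite /= !big_cons big_nil /= addr0 addrA.
Qed.

Lemma paths_sum0 (m : int) : paths_sum 0 m = (m == 0)%:R.
Proof.
rewrite /paths_sum big_mkcond (big_pred1 [tuple]) => [|p]; last first.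
  by rewrite [p]tuple0; apply/esym/eqP.
rewrite /path_weight big_nil andbT -pair_eqE /=.
by rewrite eq_sym; case: eqP.
Qed.

Lemma paths_sum_neg (n : nat) (m : int) : m < 0 -> paths_sum n m = 0.
Proof.
move=> m_lt0; apply: big_pred0 => p; apply/negP => /andP[/eqP end_p].
by move/above_axis_end; rewrite end_p /= (Order.POrderTheory.lt_geF m_lt0).
Qed.

(** Removing the last step preserves admissibility, and restoring it only adds the end point, whose
    height [m] is nonnegative. *)
Lemma paths_sumS (n : nat) (m : int) : 0 <= m ->
  paths_sum n.+1 m =
  paths_sum n (m - 1) + (x + y) * paths_sum n m + x * y * paths_sum n (m + 1).
Proof.
(* [w] extends [step_weight] to all vectors, the form that [big_step] requires. *)
move=> m_ge0; pose w (v : int * int) : {mpoly int[2]} :=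
  if v == (1, 0) then x + y else if v == (1, 1) then 1 else x * y.
rewrite {1}/paths_sum (big_tuple_rcons _ (fun p : seq step =>
  (path_end (0, 0) p == (n.+1%:Z, m)) && above_axis (0, 0) p)).
transitivity (\sum_(s : step) w (val s) * paths_sum n (m - (val s).2)).
  apply: eq_bigr => s _; rewrite /paths_sum mulr_sumr.
  apply: eq_big => [p|p _]; last first.
    by rewrite /path_weight -cats1 big_cat big_seq1 mulrC.
  have s1 : (val s).1 = 1.
    by have := valP s; rewrite !inE => /or3P[] /eqP ->.
  rewrite above_axis_rcons path_end_rcons.
  rewrite -!pair_eqE /= s1 intS [1 + _]addrC (inj_eq (addIr 1)).
  rewrite [_ == m - _]eq_sym subr_eq [m == _]eq_sym.
  by case: (_ == n%:Z) => //=; case: eqP => [->|_] //=; rewrite m_ge0 andbT.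
rewrite (big_step (fun v => w v * paths_sum n (m - v.2))) /w /=.
rewrite subr0 opprK mul1r; ring.
Qed.

End Paths.

Theorem theorem1 (n k : nat) (hn : (0 < n)%N) :
  (forall n1 : nat, n = (n1 * (k + 1))%N ->
     \det (\matrix_(i < n, j < n) Pplus (i + j) 0 k)
     = (-1) ^+ (n1 * 'C(k + 1, 2)) * (x * y) ^+ ((k + 1) ^ 2 * 'C(n1, 2)))
  /\ (n <> 0 %[mod k + 1] ->
     \det (\matrix_(i < n, j < n) Pplus (i + j) 0 k) = 0).
Proof.
pose c i j := Pplus i 0 j.
have c0 j : c 0 j = (j == 0)%N%:R.
  by rewrite -[c 0 j]/(paths_sum 0 j) paths_sum0.
have cS i j : c i.+1 j = (if j is j'.+1 then c i j' else 0)
    + (x + y) * c i j + (x * y) * c i j.+1.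
  rewrite -[c i.+1 j]/(paths_sum i.+1 j) paths_sumS //.
  have -> : j%:Z + 1 = j.+1%:Z by rewrite intS addrC.
  rewrite -[paths_sum i j]/(c i j) -[paths_sum i j.+1]/(c i j.+1).
  (* At height 0 the predecessor at height -1 contributes nothing. *)
  congr (_ + _ + _); case: j => [|j]; first by rewrite paths_sum_neg.
  by rewrite intS [1 + _]addrC addrK.
have det_eq := det_hankel_reduced c0 cS n k.
rewrite -/c {}det_eq !addn1; split => [n1 def_n | n_mod].
  by move: (det_reduced_hankel (x * y) n1 (leq0n k)); rewrite addn0 -def_n.
have le_nk : (n %% k.+1 <= k)%N by rewrite -ltnS ltn_pmod.
have := det_reduced_hankel (x * y) (n %/ k.+1) le_nk.
by rewrite -divn_eq => ->; case: eqP => // n0; case: n_mod; rewrite n0 mod0n.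
Qed.
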